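(* Consider a deterministic positive semilinear problem with data $(X,U,U(\cdot),f,g,\alpha,\widehat{\mathcal M})$ satisfying Closure and Attainability, Stabilizability, State Space Structure, and Observability (all as defined in the context), and let $J^*$ be its optimal cost function. Then there exists a vector $c^*\in\mathbb R^n_+$ with all components strictly positive such that $J^*(x)=(c^* )'x$ for all $x\in X$. Moreover, $c^*$ is the unique vector within $\mathbb R^n_+$ that satisfies $c^*=G(c^* )$.
   Context: Notation: $\mathbb R^n_+$ is the set of vectors in $\mathbb R^n$ with nonnegative components; a prime denotes transposition; vector inequalities are componentwise. Deterministic positive semilinear problem: the state space $X$ is a subset of $\mathbb R^n_+$, $U$ is a control space, and for each $x\in X$, $U(x)\subset U$ is a nonempty control constraint set. The functions $f:X\times U\to\mathbb R^n$ and $g:X\times U\to\mathbb R$ satisfy $f(x,u)\in X$ and $g(x,u)\ge 0$ for all $x\in X$, $u\in U(x)$; $\alpha\in(0,1]$ is a scalar. For $x_0\in X$, the problem is to minimize $\sum_{k=0}^\infty\alpha^k g(x_k,u_k)$ over control sequences $\{u_k\}$ subject to $x_{k+1}=f(x_k,u_k)$, $u_k\in U(x_k)$, $k=0,1,\dots$. $J^*(x_0)$ denotes the optimal cost (infimum) starting from $x_0$. A (stationary) policy is a function $\mu:X\to U$ with $\mu(x)\in U(x)$ for all $x\in X$. $\widehat{\mathcal M}$ is a given set of policies such that for every $\mu\in\widehat{\mathcal M}$ there exist an $n\times n$ nonnegative matrix $A_\mu$ and a vector $q_\mu\in\mathbb R^n$ with $f(x,\mu(x))=A_\mu x$ and $g(x,\mu(x))=q_\mu'x$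 for all $x\in X$. $\widehat{\mathcal J}$ is the set of functions $J(x)=c'x$ on $X$ with $c\in\mathbb R^n_+$. Assumptions: Closure and Attainability: for every $c\in\mathbb R^n_+$, the function $x\mapsto\min_{u\in U(x)}[g(x,u)+\alpha c'f(x,u)]$ belongs to $\widehat{\mathcal J}$, i.e., equals $\hat c'x$ for some unique $\hat c\in\mathbb R^n_+$; $\hat c$ depends continuously on $c$; and there is a policy $\mu\in\widehat{\mathcal M}$ with $\mu(x)\in\arg\min_{u\in U(x)}[g(x,u)+\alpha c'f(x,u)]$ for all $x\in X$. Stabilizability: there exists $\hat\mu\in\widehat{\mathcal M}$ such that $\alpha A_{\hat\mu}$ is stable (all its eigenvalues lie strictly within the unit circle). State Space Structure: for every $v\in\mathbb R^n_+$ there exist $x\in X$ and a scalar $s\ge0$ with $sx=v$. Observability: there exists an integer $N$ such that for every nonzero $x_0\in X$ the optimal cost of the $N$-stage problem of minimizing $\sum_{k=0}^{N-1}\alpha^k g(x_k,u_k)$ starting from $x_0$ is strictly positive. The mapping $G:\mathbb R^n_+\to\mathbb R^n_+$ is defined by letting $G(c)$ be the unique vector with $G(c)'x=\min_{u\in U(x)}[g(x,u)+\alpha c'f(x,u)]$ for all $x\in X$. *)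

(* Defs.v *)
From HB Require Import structures.
From mathcomp Require Import all_boot all_order all_algebra.
From mathcomp Require Import complex.
From mathcomp Require Import all_classical all_reals all_analysis.

Set Implicit Arguments.
Unset Strict Implicit.
Unset Printing Implicit Defensive.

Import Order.TTheory GRing.Theory Num.Theory.
Import numFieldNormedType.Exports.

Local Open Scope classical_set_scope.
Local Open Scope ring_scope.

Definition dot (R : realType) (n : nat) (c x : 'cV[R]_n) : R :=
  (c^T *m x) ord0 ord0.

(* Eigenvalues range over the complex numbers R[i]. *)
Definition stable (R : realType) (n : nat) (A : 'M[R]_n) : Prop :=
  forall z : R[i], eigenvalue (map_mx (real_complex R) A) z -> `|z| < 1.

Definition linear_under (R : realType) (n : nat) (U : Type)
    (X : set 'cV[R]_n) (f : 'cV[R]_n -> U -> 'cV[R]_n)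
    (g : 'cV[R]_n -> U -> R) (mu : 'cV[R]_n -> U)
    (A : 'M[R]_n) (q : 'cV[R]_n) : Prop :=
  A \is a mxOver Num.nneg /\
  forall x, X x -> f x (mu x) = A *m x /\ g x (mu x) = dot q x.

(* Functions of the state are total on 'cV[R]_n; only their values on the state
   space are constrained or used. *)
Record semilinear_problem (R : realType) (n : nat) := SemilinearProblem {
  state : set 'cV[R]_n;
  control : Type;
  constraint : 'cV[R]_n -> set control;
  dynamics : 'cV[R]_n -> control -> 'cV[R]_n;
  stage_cost : 'cV[R]_n -> control -> R;
  discount : R;
  linear_policies : set ('cV[R]_n -> control);
  state_nneg : forall x, state x -> x \is a mxOver Num.nneg;
  constraint_nonempty : forall x, state x -> constraint x !=set0;
  dynamics_state : forall x u,
    state x -> constraint x u -> state (dynamics x u);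
  stage_cost_ge0 : forall x u,
    state x -> constraint x u -> 0 <= stage_cost x u;
  discount_itv : 0 < discount <= 1;
  linear_policies_admissible : forall mu, linear_policies mu ->
    forall x, state x -> constraint x (mu x);
  linear_policies_linear : forall mu, linear_policies mu ->
    exists (A : 'M[R]_n) (q : 'cV[R]_n),
      linear_under state dynamics stage_cost mu A q }.

Arguments state {R n} s _.
Arguments constraint {R n} s _ _.
Arguments dynamics {R n} s _ _.
Arguments stage_cost {R n} s _ _.
Arguments linear_policies {R n} s _.

Section SemilinearProblem.
Variables (R : realType) (n : nat) (P : semilinear_problem R n).

Fixpoint trajectory (x0 : 'cV[R]_n) (u : nat -> control P) (k : nat)
    : 'cV[R]_n :=
  if k is j.+1 then dynamics P (trajectory x0 u j) (u j) else x0.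

Definition discounted_cost (x0 : 'cV[R]_n) (u : nat -> control P) (k : nat)
    : R :=
  discount P ^+ k * stage_cost P (trajectory x0 u k) (u k).

Definition optimal_cost (x0 : 'cV[R]_n) : \bar R :=
  ereal_inf [set (\sum_(0 <= k <oo) (discounted_cost x0 u k)%:E)%E
            | u in [set u | forall k, constraint P (trajectory x0 u k) (u k)]].

(* Only the controls u 0, ..., u N.-1 are constrained or used. *)
Definition finite_horizon_optimal_cost (N : nat) (x0 : 'cV[R]_n) : \bar R :=
  ereal_inf [set (\sum_(0 <= k < N) discounted_cost x0 u k)%:E
            | u in [set u | forall k, (k < N)%N ->
                              constraint P (trajectory x0 u k) (u k)]].

Definition q_factor (c x : 'cV[R]_n) (u : control P) : R :=
  stage_cost P x u + discount P * dot c (dynamics P x u).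

Definition is_argmin (c x : 'cV[R]_n) (u : control P) : Prop :=
  constraint P x u /\ forall v, constraint P x v -> q_factor c x u <= q_factor c x v.

Definition is_bellman_min (c x : 'cV[R]_n) (m : R) : Prop :=
  exists2 u, is_argmin c x u & q_factor c x u = m.

Definition bellman_vector (c : 'cV[R]_n) : set 'cV[R]_n :=
  [set d | d \is a mxOver Num.nneg /\
           forall x, state P x -> is_bellman_min c x (dot d x)].

(* The element of bellman_vector c, unique under closure_attainability; the
   default 0 is used only when there is none. *)
Definition G (c : 'cV[R]_n) : 'cV[R]_n := xget 0 (bellman_vector c).

Definition closure_attainability : Prop :=
  [/\ forall c : 'cV[R]_n, c \is a mxOver Num.nneg ->
        exists! d : 'cV[R]_n, bellman_vector c d,
      {within [set c : 'cV[R]_n | c \is a mxOver Num.nneg], continuous G} &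
      forall c : 'cV[R]_n, c \is a mxOver Num.nneg ->
        exists2 mu, linear_policies P mu &
          forall x, state P x -> is_argmin c x (mu x)].

Definition stabilizability : Prop :=
  exists2 mu, linear_policies P mu &
    exists (A : 'M[R]_n) (q : 'cV[R]_n),
      linear_under (state P) (dynamics P) (stage_cost P) mu A q /\
      stable (discount P *: A).

Definition state_space_structure : Prop :=
  forall v : 'cV[R]_n, v \is a mxOver Num.nneg ->
    exists (x : 'cV[R]_n) (s : R), [/\ state P x, 0 <= s & s *: x = v].

Definition observability : Prop :=
  exists N : nat, forall x0, state P x0 -> x0 != 0 ->
    (0 < finite_horizon_optimal_cost N x0)%E.

End SemilinearProblem.

(* Main.v *)
(* Value iteration c_k = G^k 0 is nondecreasing, and it is bounded because a
   stabilizing policy yields a vector b >= 0 with G b <= b; by continuity of G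
   its limit c is a fixed point. Every admissible cost over k stages is at least
   c_k'x, while the greedy trajectory at a fixed point costs at most c'x, so c'x
   is the optimal cost. Observability bounds c'x below by a positive finite
   horizon cost, hence c > 0, and any fixed point d satisfies
   c <= d <= K c for some K; as the tail of c vanishes along an optimal
   trajectory, so does that of d, and d = c. *)
Require Import Defs.
From mathcomp Require Import all_boot all_order all_algebra.
From mathcomp Require Import complex.
From mathcomp Require Import all_classical all_reals all_analysis.

Set Implicit Arguments.
Unset Strict Implicit.
Unset Printing Implicit Defensive.

Import Order.TTheory GRing.Theory Num.Theory.
Import numFieldNormedType.Exports.
Local Open Scope classical_set_scope.
Local Open Scope ring_scope.

(** * Supersolutions for stable nonnegative matrices *)

(** The minimum of 1 and all the values is continuous in t. Were it nonpositive at 1, it would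
    vanish at some t in [0, 1]; there all values are nonnegative and nonzero, so the minimum is
    positive, a contradiction. *)
Lemma polys_gt0_at1 (R : realType) (n : nat) (p : 'I_n -> {poly R}) :
  (forall i, 0 < (p i).[0]) ->
  (forall t, 0 <= t <= 1 -> (forall i, 0 <= (p i).[t]) ->
    forall i, (p i).[t] != 0) ->
  forall i, 0 < (p i).[1].
Proof.
move=> p0 pn0; pose m t := \big[Num.min/1]_i (p i).[t].
have m_gt0 t : (forall i, 0 < (p i).[t]) -> 0 < m t.
  by move=> pt; apply/bigmin_gtP; split.
have m_cts : continuous m.
  rewrite /m; elim: (index_enum _) => [|i s IHs] t.
    by under eq_fun do rewrite big_nil; exact: cvg_cst.
  under eq_fun do rewrite big_cons.
  by apply: continuous_min; [exact: continuous_horner|exact: IHs].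
have m1 : 0 < m 1.
  rewrite ltNge; apply/negP => m1.
  have m0 := m_gt0 0 p0.
  have [|t t01 mt] := @IVT R m 0 1 0 ler01 (continuous_subspaceT m_cts).
    by rewrite ge_min m1 orbT le_max (ltW m0).
  have pt i : 0 <= (p i).[t].
    by have /bigmin_geP[_ ->] : 0 <= m t by rewrite mt.
  have : 0 < m t by apply: m_gt0 => i; rewrite lt_neqAle eq_sym pn0 ?pt.
  by rewrite mt ltxx.
by move/bigmin_gtP : m1 => [_ +] i; apply.
Qed.

(** For t > 0 a zero determinant makes 1/t an eigenvalue of A, of modulus at least 1. *)
Lemma stable_det_neq0 (R : realType) (n : nat) (A : 'M[R]_n) (t : R) :
  stable A -> 0 <= t <= 1 -> \det (1%:M - t *: A) != 0.
Proof.
move=> sA /andP[t0 t1]; apply/eqP => det0.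
have {}t0 : 0 < t.
  rewrite lt_neqAle t0 andbT; apply/eqP => t0'; move: det0.
  by rewrite -t0' scale0r subr0 det1; apply/eqP; rewrite oner_eq0.
have : eigenvalue A t^-1.
  rewrite /eigenvalue /eigenspace kermx_eq0 row_free_unit unitmxE unitfE negbK.
  have -> : A - t^-1%:M = (- t^-1) *: (1%:M - t *: A).
    rewrite scalerBr scalerA mulNr mulVf ?gt_eqF // scaleN1r opprK.
    by rewrite scalemx1 addrC; congr (_ + _); rewrite raddfN.
  by rewrite detZ det0 mulr0.
rewrite -(eigenvalue_map (real_complex R)) => /sA.
rewrite normc_def /= expr0n addr0 sqrtr_sqr ltcR gtr0_norm ?invr_gt0 //.
by rewrite invf_lt1 // ltNge t1.
Qed.

(* With b t = (1 - t A)^-1 q, the smallest entry of b is positive at t = 0 and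
   never vanishes on [0, 1]: if b t >= 0 then b t = q + t A (b t) > 0. *)
Lemma stable_supersolution (R : realType) (n : nat) (A : 'M[R]_n)
    (q : 'cV[R]_n) :
  A \is a mxOver Num.nneg -> stable A ->
  exists2 b : 'cV[R]_n, b \is a mxOver Num.nneg &
    forall i, q i ord0 + (A *m b) i ord0 <= b i ord0.
Proof.
move=> /mxOverP A0 sA.
(* Since q may have any sign, it is replaced by a strictly positive vector that dominates it. *)
pose q' : 'cV[R]_n := \col_i (`|q i ord0| + 1).
have q'0 i : 0 < q' i ord0 by rewrite mxE ltr_wpDl.
pose M : 'M[{poly R}]_n := 1%:M - 'X *: map_mx polyC A.
pose Mt t := 1%:M - t *: A.
have M_horner t : map_mx (horner_eval t) M = Mt t.
  apply/matrixP => i j; rewrite !mxE /horner_eval !hornerE.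
  by case: (i == j); rewrite !hornerE.
have det_gt0 t : 0 <= t <= 1 -> 0 < \det (Mt t).
  move=> /andP[t0 t1].
  (* Rescaling by t moves the endpoint to s = 1, so that [polys_gt0_at1] applies to a single
     polynomial. *)
  have detE s : \det (Mt (s * t)) = (\det M \Po (t *: 'X)).[s].
    by rewrite horner_comp hornerZ hornerX mulrC -M_horner det_map_mx.
  have := @polys_gt0_at1 R 1 (fun=> \det M \Po (t *: 'X)).
  rewrite -[X in 0 < \det (Mt X)]mul1r detE; apply => //; last exact: ord0.
    by move=> _; rewrite -detE mul0r /Mt scale0r subr0 det1.
  move=> s /andP[s0 s1] _ _; rewrite -detE; apply: stable_det_neq0 => //.
  by rewrite mulr_ge0 // mulr_ile1.
(* The adjugate stands in for the inverse: the entries of p are polynomials in t, and p t is (1 - t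
   A)^-1 q' times a positive determinant. *)
pose p := \adj M *m map_mx polyC q'.
have p_horner t : map_mx (horner_eval t) p = \adj (Mt t) *m q'.
  rewrite map_mxM map_mx_adj M_horner; congr (_ *m _).
  by apply/matrixP => i j; rewrite !mxE; exact: hornerC.
have pE t i : (p i ord0).[t] = (\adj (Mt t) *m q') i ord0.
  by rewrite -p_horner [RHS]mxE.
have p_eq t i : (p i ord0).[t] =
    \det (Mt t) * q' i ord0 + t * \sum_j A i j * (p j ord0).[t].
  have key (X r : 'cV[R]_n) d : Mt t *m X = d *: r ->
      X i ord0 = d * r i ord0 + t * \sum_j A i j * X j ord0.
    rewrite mulmxBl mul1mx -scalemxAl => /matrixP/(_ i ord0).
    by rewrite !mxE => <-; rewrite subrK.
  rewrite pE; under eq_bigr do rewrite pE.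
  by apply: key; rewrite mulmxA mul_mx_adj mul_scalar_mx.
have p1_gt0 : forall i, 0 < (p i ord0).[1].
  apply: polys_gt0_at1 => [i|t t01 pt i].
    by rewrite p_eq mul0r addr0 mulr_gt0 ?det_gt0 ?lexx ?ler01.
  rewrite p_eq gt_eqF // ltr_wpDr ?mulr_gt0 ?det_gt0 //.
  rewrite mulr_ge0 ?sumr_ge0 //; first by case/andP: t01.
  by move=> j _; rewrite mulr_ge0 // -nnegrE.
have d1 : 0 < \det (Mt 1) by rewrite det_gt0 ?ler01 ?lexx.
exists (\col_i ((p i ord0).[1] / \det (Mt 1))).
  by apply/mxOverP => i j; rewrite mxE nnegrE divr_ge0 ?ltW.
move=> i; rewrite [leRHS]mxE p_eq mul1r mulrDl mulrAC divff ?gt_eqF // mul1r.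
rewrite lerD //; first by rewrite mxE (le_trans (ler_norm _)) ?lerDl.
rewrite mxE mulr_suml ler_sum // => j _.
by rewrite mxE mulrA.
Qed.

(** Cost vectors evolve under the transpose, as c'(A x) = (A'c)'x. *)
Lemma stable_trmx (R : realType) (n : nat) (A : 'M[R]_n) :
  stable A -> stable A^T.
Proof.
move=> sA z ez; apply: sA; move: ez.
rewrite /eigenvalue /eigenspace !kermx_eq0 !row_free_unit -map_trmx.
by rewrite -[in X in X -> _]unitmx_tr linearB /= trmxK tr_scalar_mx.
Qed.

Lemma cvg_mx_coord (R : realFieldType) (m n : nat) (u : nat -> 'M[R]_(m, n))
    (l : 'M[R]_(m, n)) :
  (forall i j, (fun k => u k i j) @ \oo --> l i j) -> u @ \oo --> l.
Proof.
move=> ul A [B lB BA].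
suff : \forall k \near \oo, forall i j, B i j (u k i j).
  by apply: filterS => k /BA.
by apply: filter_forall => i; apply: filter_forall => j; exact: ul (lB i j).
Qed.

(** * The pairing c'x *)

Section Dot.
Variables (R : realType) (n : nat).
Implicit Types a b c x : 'cV[R]_n.

Lemma dotE c x : dot c x = \sum_i c i ord0 * x i ord0.
Proof. by rewrite /dot mxE; apply: eq_bigr => i _; rewrite mxE. Qed.

Lemma dot_mulmx c (A : 'M[R]_n) x : dot c (A *m x) = dot (A^T *m c) x.
Proof. by rewrite /dot trmx_mul trmxK mulmxA. Qed.

Lemma dotDl a b x : dot (a + b) x = dot a x + dot b x.
Proof. by rewrite /dot linearD mulmxDl mxE. Qed.

Lemma dotZl s c x : dot (s *: c) x = s * dot c x.
Proof. by rewrite /dot linearZ -scalemxAl mxE. Qed.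

Lemma dotZr s c x : dot c (s *: x) = s * dot c x.
Proof. by rewrite /dot -scalemxAr mxE. Qed.

Lemma dot0l x : dot 0 x = 0.
Proof. by rewrite /dot trmx0 mul0mx mxE. Qed.

Lemma dot_delta c i : dot c (delta_mx i ord0) = c i ord0.
Proof. by rewrite /dot -colE !mxE. Qed.

Lemma delta_mx_nneg i : (delta_mx i ord0 : 'cV[R]_n) \is a mxOver Num.nneg.
Proof. by apply/mxOverP => j k; rewrite mxE nnegrE ler0n. Qed.

Lemma ler_dot2r a b x : (forall i, a i ord0 <= b i ord0) ->
  x \is a mxOver Num.nneg -> dot a x <= dot b x.
Proof.
move=> ab /mxOverP x0; rewrite !dotE ler_sum // => i _.
by rewrite ler_wpM2r // -nnegrE.
Qed.

Lemma dot_ge0 c x : c \is a mxOver Num.nneg -> x \is a mxOver Num.nneg ->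
  0 <= dot c x.
Proof.
move=> /mxOverP c0 x0; rewrite -(dot0l x) ler_dot2r // => i.
by rewrite mxE -nnegrE.
Qed.

Lemma cvg_dotl (u : nat -> 'cV[R]_n) c x :
  (forall i, (fun k => u k i ord0) @ \oo --> c i ord0) ->
  (fun k => dot (u k) x) @ \oo --> dot c x.
Proof.
move=> uc; rewrite dotE; under eq_fun do rewrite dotE.
apply: cvg_big => [|i _]; [exact: add_continuous|exact: cvgMr_tmp].
Qed.

End Dot.

(** * The Bellman operator [G] on the nonnegative orthant *)

Section ValueIteration.
Variables (R : realType) (n : nat) (P : semilinear_problem R n).
Hypothesis hclosure : closure_attainability P.
Hypothesis hstate : state_space_structure P.

Local Notation alpha := (discount P).
Local Notation nneg c := (c \is a mxOver Num.nneg).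
Local Notation admissible x0 u :=
  (forall k, constraint P (trajectory x0 u k) (u k)).
Local Notation cost x0 u N := (\sum_(0 <= k < N) discounted_cost x0 u k).

Lemma nneg0 : nneg (0 : 'cV[R]_n).
Proof. by apply/mxOverP => i j; rewrite mxE nnegrE. Qed.

Lemma discount_ge0 : 0 <= alpha.
Proof. by case/andP: (discount_itv P) => /ltW. Qed.

(** Each unit vector is a nonnegative multiple of a state, so linear functions compared on the
    states are compared coordinatewise. *)
Lemma ler_coord_dot (a b : 'cV[R]_n) :
  (forall x, state P x -> dot a x <= dot b x) ->
  forall i, a i ord0 <= b i ord0.
Proof.
move=> ab i; have [x [s [Px s0 sx]]] := hstate (delta_mx_nneg R i).
by rewrite -!dot_delta -sx !dotZr ler_wpM2l // ab.
Qed.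

Lemma bellman_vector_G (c : 'cV[R]_n) : nneg c -> bellman_vector P c (G P c).
Proof.
by case: hclosure => exG _ _ /exG[d [dP _]]; apply: xgetPex; exists d.
Qed.

Lemma G_nneg (c : 'cV[R]_n) : nneg c -> nneg (G P c).
Proof. by case/bellman_vector_G. Qed.

Lemma iter_G_nneg k (c : 'cV[R]_n) : nneg c -> nneg (iter k (G P) c).
Proof. by move=> c0; elim: k => //= k; exact: G_nneg. Qed.

Lemma dot_G_le (c x : 'cV[R]_n) (u : control P) :
  nneg c -> state P x -> constraint P x u ->
  dot (G P c) x <= q_factor c x u.
Proof.
by move=> /bellman_vector_G[_ Gc] /Gc[v [_ vmin] <-]; exact: vmin.
Qed.

Lemma dot_G_argmin (c x : 'cV[R]_n) (u : control P) : nneg c -> state P x ->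
  is_argmin c x u -> dot (G P c) x = q_factor c x u.
Proof.
move=> c0 Px [Uu umin]; apply/le_anti; rewrite dot_G_le //=.
have [_ Gc] := bellman_vector_G c0.
by have [v [Uv _] <-] := Gc x Px; exact: umin.
Qed.

(** A minimizing control for d is admissible for c, and its cost is no larger there because the next
    state is nonnegative. *)
Lemma G_monotone (c d : 'cV[R]_n) : nneg c -> nneg d ->
  (forall i, c i ord0 <= d i ord0) -> forall i, G P c i ord0 <= G P d i ord0.
Proof.
move=> c0 d0 cd; apply: ler_coord_dot => x Px.
have [_ Gd] := bellman_vector_G d0.
have [v [Uv _] <-] := Gd x Px; apply: le_trans (dot_G_le c0 Px Uv) _.
rewrite lerD2l ler_wpM2l ?discount_ge0 // ler_dot2r //.
exact/state_nneg/dynamics_state.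
Qed.

Lemma iter_G_monotone k (c d : 'cV[R]_n) : nneg c -> nneg d ->
  (forall i, c i ord0 <= d i ord0) ->
  forall i, iter k (G P) c i ord0 <= iter k (G P) d i ord0.
Proof.
move=> c0 d0 cd; elim: k => //= k IHk.
by apply: G_monotone => //; exact: iter_G_nneg.
Qed.

(** * Costs along trajectories *)

Lemma trajectory_state (x0 : 'cV[R]_n) (u : nat -> control P) :
  state P x0 -> admissible x0 u -> forall k, state P (trajectory x0 u k).
Proof.
by move=> Px0 Uu; elim=> //= k IHk; exact: dynamics_state.
Qed.

Lemma discounted_cost_ge0 (x0 : 'cV[R]_n) (u : nat -> control P) :
  state P x0 -> admissible x0 u -> forall k, 0 <= discounted_cost x0 u k.
Proof.
move=> Px0 Uu k; rewrite mulr_ge0 ?exprn_ge0 ?discount_ge0 //.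
exact: stage_cost_ge0 (trajectory_state Px0 Uu k) (Uu k).
Qed.

(** Induction on N with the terminal vector c varying: the bound with terminal vector [G P c] holds,
    and Bellman minimality at the N-th state turns that terminal term into one more stage with
    terminal vector c. *)
Lemma dot_iter_G_le (c x0 : 'cV[R]_n) (u : nat -> control P) N :
  nneg c -> state P x0 -> admissible x0 u ->
  dot (iter N (G P) c) x0 <=
    cost x0 u N + alpha ^+ N * dot c (trajectory x0 u N).
Proof.
move=> c0 Px0 Uu; elim: N c c0 => [|N IHN] c c0.
  by rewrite big_nil expr0 mul1r add0r.
rewrite iterSr (le_trans (IHN _ (G_nneg c0))) // big_nat_recr //= -addrA lerD2l.
rewrite exprSr -mulrA -mulrDr ler_wpM2l ?exprn_ge0 ?discount_ge0 //.
exact: dot_G_le (trajectory_state Px0 Uu N) (Uu N).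
Qed.

(** A policy greedy for c attains the Bellman minimum at every state, so c'x splits exactly into
    stage cost and discounted remainder at each step. *)
Lemma fixed_point_trajectory (c x0 : 'cV[R]_n) :
  nneg c -> c = G P c -> state P x0 ->
  exists2 u : nat -> control P, admissible x0 u &
    forall N, dot c x0 = cost x0 u N + alpha ^+ N * dot c (trajectory x0 u N).
Proof.
move=> c0 cG Px0; have [_ _ /(_ c c0)[mu _ mu_min]] := hclosure.
(* [trajectory] takes a control sequence, not a policy; the closed-loop states are built first and
   the controls read off them. *)
pose y k := iter k (fun x => dynamics P x (mu x)) x0.
pose u k := mu (y k).
have yE k : trajectory x0 u k = y k by elim: k => //= k ->.
have Py k : state P (y k).
  by elim: k => //= k IHk; apply: dynamics_state => //; case: (mu_min _ IHk).
exists u => [k|N]; first by rewrite yE; case: (mu_min _ (Py k)).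
elim: N => [|N ->]; first by rewrite big_nil expr0 mul1r add0r.
rewrite big_nat_recr //= -addrA; congr (_ + _).
rewrite {1}cG yE (dot_G_argmin c0 (Py N) (mu_min _ (Py N))).
by rewrite /discounted_cost yE exprSr -mulrA -mulrDr.
Qed.

Lemma fixed_point_le_cost (c x0 : 'cV[R]_n) (u : nat -> control P) N :
  state P x0 -> nneg c -> admissible x0 u ->
  dot c x0 = cost x0 u N + alpha ^+ N * dot c (trajectory x0 u N) ->
  cost x0 u N <= dot c x0.
Proof.
move=> Px0 c0 Uu ->; rewrite lerDl mulr_ge0 ?exprn_ge0 ?discount_ge0 //.
by rewrite dot_ge0 //; exact/state_nneg/trajectory_state.
Qed.

(** * Positivity, existence, optimality and uniqueness of the fixed point *)

(** The i-th unit vector is s x with s > 0 and x a nonzero state, so the i-th entry of c is s c'x,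
    and c'x dominates the N-stage cost of the greedy controls. *)
Lemma fixed_point_pos (c : 'cV[R]_n) : observability P ->
  nneg c -> c = G P c -> c \is a mxOver Num.pos.
Proof.
move=> [N hN] c0 cG; apply/mxOverP => i j; rewrite ord1 posrE {j}.
have [x [s [Px s0 sx]]] := hstate (delta_mx_nneg R i).
have dneq0 : (delta_mx i ord0 : 'cV[R]_n) != 0.
  apply/eqP => /matrixP/(_ i ord0); rewrite !mxE !eqxx => /eqP.
  by rewrite oner_eq0.
have [s_neq0 x_neq0] : s != 0 /\ x != 0.
  by apply/andP; move: dneq0; rewrite -sx scaler_eq0 negb_or.
rewrite -dot_delta -sx dotZr mulr_gt0 //.
  by rewrite lt_neqAle eq_sym s_neq0.
have [u Uu cE] := fixed_point_trajectory c0 cG Px.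
apply: lt_le_trans (fixed_point_le_cost Px c0 Uu (cE N)).
rewrite -lte_fin; apply: lt_le_trans (hN x Px x_neq0) _.
by apply: ereal_inf_lbound; exists u => // k _.
Qed.

(** If b >= q + alpha A'b for the stabilizing policy, then b'x is at least the cost of following
    that policy for one stage with terminal vector b, hence at least (G b)'x. *)
Lemma stabilizable_supersolution : stabilizability P ->
  exists2 b : 'cV[R]_n, nneg b & forall i, G P b i ord0 <= b i ord0.
Proof.
move=> [mu lin_mu [A [q [[A0 Amu] sA]]]].
have A0' : discount P *: A^T \is a mxOver Num.nneg.
  apply/mxOverP => i j; rewrite !mxE nnegrE mulr_ge0 ?discount_ge0 //.
  by rewrite -nnegrE; move/mxOverP : A0; apply.
have sA' : stable (discount P *: A^T) by rewrite -linearZ; exact: stable_trmx.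
have [b b0 bq] := stable_supersolution q A0' sA'; exists b => //.
apply: ler_coord_dot => x Px; have [fE gE] := Amu x Px.
apply: le_trans (dot_G_le b0 Px (linear_policies_admissible lin_mu Px)) _.
rewrite /q_factor fE gE dot_mulmx -dotZl -dotDl.
apply: ler_dot2r; last exact: state_nneg Px.
by move=> i; rewrite mxE scalemxAl.
Qed.

Lemma value_iteration_cvg (b : 'cV[R]_n) :
  nneg b -> (forall i, G P b i ord0 <= b i ord0) ->
  exists c : 'cV[R]_n, [/\ nneg c, c = G P c &
    forall i, (fun k => iter k (G P) 0 i ord0) @ \oo --> c i ord0].
Proof.
move=> b0 Gb; pose C k : 'cV[R]_n := iter k (G P) 0.
have z0 := nneg0.
have C0 k : nneg (C k) by exact: iter_G_nneg.
have Cge0 k i : 0 <= C k i ord0.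
  by rewrite -nnegrE; move/mxOverP : (C0 k); apply.
have Cb k i : C k i ord0 <= b i ord0.
  elim: k i => [|k IHk] i.
    by rewrite mxE -nnegrE; move/mxOverP : b0; apply.
  by apply: le_trans (Gb i); apply: G_monotone.
have Cnd i : nondecreasing_seq (fun k => C k i ord0).
  (* The (k+1)-st iterate is G^k applied to G 0, and 0 <= G 0. *)
  apply/nondecreasing_seqP => k; rewrite /C iterSr.
  apply: iter_G_monotone => //; first exact: G_nneg.
  by move=> j; rewrite mxE (Cge0 1%N).
have Ccvg i : cvgn (fun k => C k i ord0).
  by apply: nondecreasing_is_cvgn => //; exists (b i ord0) => _ [k _ <-].
pose c : 'cV[R]_n := \col_i limn (fun k => C k i ord0).
have Cc i : (fun k => C k i ord0) @ \oo --> c i ord0 by rewrite mxE.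
have c0 : nneg c.
  apply/mxOverP => i j; rewrite mxE nnegrE.
  exact: le_trans (Cge0 0 i) (nondecreasing_cvgn_le (Cnd i) (Ccvg i) 0).
exists c; split => //; apply/matrixP => i j; rewrite ord1 {j}.
(* Continuity of [G] is relative to the orthant; the iterates and their limit lie in it. *)
have Gc : (fun k => G P (C k)) @ \oo --> G P c.
  have [_ /subspace_continuousP/(_ _ c0) Gc _] := hclosure.
  have CC : C @ \oo --> c by apply: cvg_mx_coord => j k; rewrite ord1.
  by move=> Q /Gc /CC[N _ NQ]; exists N => // k /NQ; apply; exact: C0.
have C1c : (fun k => C k.+1 i ord0) @ \oo --> c i ord0.
  by rewrite (cvg_shiftS (fun k => C k i ord0)).
rewrite -(cvg_lim _ C1c) //; apply: cvg_lim => //.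
exact: (continuous_cvg _ (@coord_continuous _ _ _ i ord0 _) Gc).
Qed.

Lemma optimal_cost_fixed_point (c x : 'cV[R]_n) : nneg c -> c = G P c ->
  (forall i, (fun k => iter k (G P) 0 i ord0) @ \oo --> c i ord0) ->
  state P x -> optimal_cost P x = (dot c x)%:E.
Proof.
move=> c0 cG Cc Px; apply/le_anti/andP; split.
  (* Upper bound: every partial cost of the greedy controls is at most c'x. *)
  have [u Uu cE] := fixed_point_trajectory c0 cG Px.
  apply: (@le_trans _ _ (\sum_(0 <= k <oo) (discounted_cost x u k)%:E)%E).
    by apply: ereal_inf_lbound; exists u.
  apply: lime_le.
    by apply: is_cvg_nneseries => k _ _; rewrite lee_fin discounted_cost_ge0.
  apply: nearW => N; rewrite sumEFin lee_fin.
  exact: fixed_point_le_cost (cE N).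
(* Lower bound: with zero terminal vector, (G^N 0)'x is below the N-stage cost of any admissible
   controls; N then tends to infinity. *)
apply: le_ereal_inf_tmp => _ [u Uu <-].
have z0 := nneg0.
have Ccx : (fun k => (dot (iter k (G P) 0) x)%:E) @ \oo --> (dot c x)%:E.
  by apply: cvg_EFin; [exact: nearW|exact: cvg_dotl].
rewrite -(cvg_lim _ Ccx) //; apply: lime_le.
  by apply/cvg_ex; eexists; exact: Ccx.
apply: nearW => N; apply: le_trans (nneseries_lim_ge N _); last first.
  by move=> k _ _; rewrite lee_fin discounted_cost_ge0.
rewrite sumEFin lee_fin (le_trans (dot_iter_G_le N z0 Px Uu)) //.
by rewrite dot0l mulr0 addr0.
Qed.

(* Along an optimal trajectory the c-tail is at most c'x - (G^N 0)'x, which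
   tends to 0; as d <= K c, so does the d-tail. *)
Lemma fixed_point_unique (c d : 'cV[R]_n) :
  c \is a mxOver Num.pos -> nneg d -> c = G P c -> d = G P d ->
  (forall i, (fun k => iter k (G P) 0 i ord0) @ \oo --> c i ord0) -> d = c.
Proof.
move=> /mxOverP cpos d0 cG dG Cc.
have c0 : nneg c by apply/mxOverP => i j; rewrite nnegrE ltW // -posrE.
have z0 := nneg0.
have iter_fix (e : 'cV[R]_n) N : e = G P e -> iter N (G P) e = e.
  by move=> eG; elim: N => //= N ->.
(* As 0 <= d and d is fixed, every iterate from 0 stays below d. *)
have cd i : c i ord0 <= d i ord0.
  rewrite -(cvg_lim _ (Cc i)) //; apply: limr_le.
    by apply/cvg_ex; eexists; exact: Cc.
  apply: nearW => N; rewrite -(iter_fix d N dG); apply: iter_G_monotone => //.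
  by move=> j; rewrite mxE -nnegrE; move/mxOverP : d0; apply.
suff dc i : d i ord0 <= c i ord0.
  by apply/matrixP => i j; rewrite ord1; apply/le_anti; rewrite cd dc.
apply: ler_coord_dot i => x Px.
(* A sum of nonnegative ratios bounds each of them, whence d <= K c. *)
pose K := \sum_i d i ord0 / c i ord0.
have dKc i : d i ord0 <= (K *: c) i ord0.
  rewrite mxE /K -ler_pdivrMr; last by rewrite -posrE.
  rewrite (bigD1 i) //= lerDl sumr_ge0 // => j _.
  by rewrite divr_ge0 // -nnegrE; [move/mxOverP : d0|move/mxOverP : c0]; apply.
have K0 : 0 <= K.
  rewrite sumr_ge0 // => j _.
  by rewrite divr_ge0 // -nnegrE; [move/mxOverP : d0|move/mxOverP : c0]; apply.
have [u Uu cE] := fixed_point_trajectory c0 cG Px.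
have bound N : dot d x <= dot c x + K * (dot c x - dot (iter N (G P) 0) x).
  have tail : alpha ^+ N * dot d (trajectory x u N) <=
      K * (alpha ^+ N * dot c (trajectory x u N)).
    rewrite mulrCA -(dotZl K) ler_wpM2l ?exprn_ge0 ?discount_ge0 //.
    rewrite ler_dot2r //; exact/state_nneg/trajectory_state.
  (* Reading d as G^N d bounds d'x by the N-stage cost, at most c'x, plus the d-tail. *)
  rewrite -{1}(iter_fix d N dG) (le_trans (dot_iter_G_le N d0 Px Uu)) //.
  rewrite lerD ?(fixed_point_le_cost Px c0 Uu (cE N)) // (le_trans tail) //.
  rewrite ler_wpM2l // {1}(cE N) addrAC lerDr subr_ge0.
  by rewrite (le_trans (dot_iter_G_le N z0 Px Uu)) // dot0l mulr0 addr0.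
have lim_bound : (fun N => dot c x + K * (dot c x - dot (iter N (G P) 0) x))
    @ \oo --> dot c x.
  rewrite -[X in _ --> X]addr0 -[X in _ --> _ + X](mulr0 K) -(subrr (dot c x)).
  apply: cvgD; first exact: cvg_cst.
  apply: cvgMl_tmp; apply: cvgB; first exact: cvg_cst.
  exact: cvg_dotl.
rewrite -(cvg_lim _ lim_bound) //; apply: limr_ge.
  by apply/cvg_ex; eexists; exact: lim_bound.
exact: nearW.
Qed.

End ValueIteration.

Theorem proposition1 (R : realType) (n : nat) (P : semilinear_problem R n)
    (hclosure : closure_attainability P) (hstab : stabilizability P)
    (hstate : state_space_structure P) (hobs : observability P) :
  exists c : 'cV[R]_n,
    [/\ c \is a mxOver Num.pos,
        forall x, state P x -> optimal_cost P x = (dot c x)%:E,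
        c = G P c &
        forall d : 'cV[R]_n, d \is a mxOver Num.nneg -> d = G P d -> d = c].
Proof.
have [b b0 Gb] := stabilizable_supersolution hclosure hstate hstab.
have [c [c0 cG Cc]] := value_iteration_cvg hclosure hstate b0 Gb.
have cpos := fixed_point_pos hclosure hstate hobs c0 cG.
exists c; split => // [x Px|d d0 dG].
- exact: optimal_cost_fixed_point.
- exact: fixed_point_unique cG dG Cc.
Qed.
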